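(* Let $T$ be a countable tree of sequences, let $\Xi$ be an inductive probability measure on $T$, and let $A$ be a front of $T$. Then $\Xi\upharpoonright\mathcal P(A)$ is a probability measure. Moreover, for any $t\in T$ that is below some member of $A$ (i.e. $t\subseteq s$ for some $s\in A$), $$\Xi(\{t\})=\Xi(\{s\in A : t\subseteq s\}).$$
   Context: A tree (of sequences) is a non-empty set $T$ of finite sequences with entries in some set, closed under initial segments and ordered by $s\subseteq t$ ($t$ extends $s$); its root is the empty sequence $\langle\,\rangle$. $\mathrm{succ}_T(t)$ is the set of $t'\in T$ extending $t$ with $|t'|=|t|+1$; $\max T$ is the set of $t\in T$ with $\mathrm{succ}_T(t)=\emptyset$; $\lim T$ is the set of infinite sequences $x$ with $x\upharpoonright n\in T$ for all $n<\omega$; $[T]=\lim T\cup\max T$ is the set of maximal branches. For $x$ of finite length, $x\upharpoonright n=x$ when $n\ge|x|$. An inductive probability measure on $T$ is a ($\sigma$-additive, $[0,\infty]$-valued) measure $\Xi$ on $\mathcal P(T)$ such that $\Xi(\{\langle\,\rangle\})=1$ and $\Xi(\mathrm{succ}_T(t))=\Xi(\{t\})$ for all $t\in T\smallsetminus\max T$. A set $A\subseteq T$ is a front of $T$ if (i) any two distinct members of $A$ are incompatible (neither extends the other), and (ii) for any $x\in[T]$ there is some $n<\omega$ such that $x\upharpoonright n\in A$. *)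

(* Defs.v *)
From HB Require Import structures.
From mathcomp Require Import all_boot all_order all_algebra.
From mathcomp Require Import all_classical all_reals all_analysis.

Set Implicit Arguments.
Unset Strict Implicit.
Unset Printing Implicit Defensive.

Local Open Scope classical_set_scope.
Local Open Scope ring_scope.
Local Open Scope ereal_scope.

(* [powerset_space S0] is the set S, as a type, with the sigma-algebra of all
   its subsets, so that a measure on it is a measure on P(S).  The library
   requires measurable spaces to be pointed, hence the proof S0 that S is
   nonempty; only the choice of the irrelevant point depends on it. *)
Definition powerset_space (U : Type) (S : set U) (S0 : S !=set0) : Type :=
  set_type S.

Section powerset_space.
Context (U : Type) (S : set U) (S0 : S !=set0).
Local Notation PS := (powerset_space S0).

HB.instance Definition _ := gen_eqMixin PS.
HB.instance Definition _ := gen_choiceMixin PS.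
HB.instance Definition _ :=
  isPointed.Build PS (exist _ (sval (cid S0)) (mem_set (svalP (cid S0)))).
HB.instance Definition _ := @isMeasurable.Build default_measure_display PS
  discrete_measurable discrete_measurable0
  discrete_measurableC discrete_measurableU.

(* A subset B of S, seen as a set of points of the space (B `&` S in general). *)
Definition subset_of (B : set U) : set PS := [set x | B (sval x)].

End powerset_space.
Arguments subset_of {U S S0} B.

Section trees.
Context (X : Type).

(* t extends s *)
Definition initial (s t : seq X) : Prop := exists u, t = s ++ u.

Record tree := Tree {
  nodes : set (seq X) ;
  nodes_neq0 : nodes !=set0 ;
  nodes_initial : forall s t, initial s t -> nodes t -> nodes s }.

Definition tree_succ (T : tree) (t : seq X) : set (seq X) :=
  [set t' | [/\ nodes T t', initial t t' & size t' = (size t).+1]].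

Definition tree_max (T : tree) : set (seq X) :=
  [set t | nodes T t /\ tree_succ T t = set0].

Definition tree_lim (T : tree) : set (nat -> X) :=
  [set x | forall n, nodes T (mkseq x n)].

Definition sequence_le_omega : Type := ((nat -> X) + seq X)%type.

Definition restrict (x : sequence_le_omega) (n : nat) : seq X :=
  match x with inl f => mkseq f n | inr s => take n s end.

(* maximal branches *)
Definition branches (T : tree) : set sequence_le_omega :=
  inl @` tree_lim T `|` inr @` tree_max T.

Definition front (T : tree) (A : set (seq X)) : Prop :=
  [/\ A `<=` nodes T,
      forall s t, A s -> A t -> s <> t -> ~ initial s t /\ ~ initial t s
    & forall x, branches T x -> exists n, A (restrict x n)].

Definition inductive_probability (R : realType) (T : tree)
    (Xi : {measure set (powerset_space (nodes_neq0 T)) -> \bar R}) : Prop :=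
  Xi (subset_of [set [::]]) = 1 /\
  forall t, nodes T t -> ~ tree_max T t ->
    Xi (subset_of (tree_succ T t)) = Xi (subset_of [set t]).

End trees.

(* Main.v *)
(* Above a node with no proper initial segment in the front A, the part of T
   not yet past A has no infinite branch, so bar induction applies: at a node t
   outside A, t is not maximal, the part of A above t is the disjoint union of
   the parts of A above the countably many successors of t, and the mass of t
   is the mass of its successors.  At the root this gives mass 1 for A, so in
   particular A is nonempty. *)
Require Import Defs.
From HB Require Import structures.
From mathcomp Require Import all_boot all_order all_algebra.
From mathcomp Require Import all_classical all_reals all_analysis.

Local Open Scope classical_set_scope.
Local Open Scope ring_scope.
Local Open Scope ereal_scope.

(** An injection [e] of [D] into the natural numbers turns both unions into disjoint unions of
    sequences, whose measures are series with equal terms. *)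
Lemma measure_countable_bigcup_eq d (T : measurableType d) (R : realType)
    (mu : {measure set T -> \bar R}) (I : Type) (D : set I) (F G : I -> set T) :
  countable D ->
  (forall i, D i -> measurable (F i)) -> (forall i, D i -> measurable (G i)) ->
  trivIset D F -> trivIset D G -> (forall i, D i -> mu (F i) = mu (G i)) ->
  mu (\bigcup_(i in D) F i) = mu (\bigcup_(i in D) G i).
Proof.
move=> /countable_injP[e einj] mF mG tF tG FG.
(* The layer at [n] is [H i] when [n = e i] and is empty when [n] codes no index, so no inverse of
   [e] has to be chosen. *)
pose layer (H : I -> set T) n := \bigcup_(i in D `&` e @^-1` [set n]) H i.
have layerE i H : D i -> layer H (e i) = H i.
  move=> Di; apply/seteqP; split => [x [j [Dj ej] Hj]|x Hx].
    by rewrite (einj i j) ?inE.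
  by exists i.
have layerP H n : layer H n = set0 \/ exists2 i, D i & e i = n.
  have [[i [Di ei]]|noi] := pselect (exists i, D i /\ e i = n).
    by right; exists i.
  by left; rewrite -subset0 => x [i [Di ei] _]; apply: noi; exists i.
have unionE H : \bigcup_(i in D) H i = \bigcup_n layer H n.
  apply/seteqP; split => [x [i Di Hx]|x [n _ [i [Di _] Hx]]].
    by exists (e i) => //; rewrite layerE.
  by exists i.
have mlayer H n : (forall i, D i -> measurable (H i)) -> measurable (layer H n).
  move=> mH; have [->|[i Di <-]] := layerP H n; first exact: measurable0.
  by rewrite layerE//; exact: mH.
have tlayer H : trivIset D H -> trivIset setT (layer H).
  move=> tH m n _ _ [x [[i [Di ei] Hi] [j [Dj ej] Hj]]].
  have ij : i = j by apply: tH => //; exists x.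
  by rewrite -ei -ej ij.
rewrite !unionE !measure_semi_bigcup //.
- apply: eq_eseriesr => n _.
  have [|[i Di <-]] := layerP F n; last by rewrite !layerE ?FG.
  have [->->//|[i Di <-] _] := layerP G n.
  by rewrite !layerE ?FG.
- by move=> n; exact: mlayer.
- exact: tlayer.
- by apply: bigcup_measurable => n _; exact: mlayer.
- by move=> n; exact: mlayer.
- exact: tlayer.
- by apply: bigcup_measurable => n _; exact: mlayer.
Qed.

(** * Restriction of a measure to the subsets of [A] *)

Section restriction.
Context (R : realType) (U : Type) (S : set U) (S0 : S !=set0).
Context (mu : {measure set (powerset_space S0) -> \bar R}).
Context (A : set U) (A0 : A !=set0).

Definition measure_restriction (B : set (powerset_space A0)) : \bar R :=
  mu (subset_of (sval @` B)).

Let restriction0 : measure_restriction set0 = 0.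
Proof.
rewrite /measure_restriction image_set0 -[RHS](measure0 mu).
by congr (mu _); apply/seteqP; split.
Qed.

Let restriction_ge0 B : 0 <= measure_restriction B.
Proof. exact: measure_ge0. Qed.

Let restriction_sigma_additive : semi_sigma_additive measure_restriction.
Proof.
move=> F _ tF _; rewrite /measure_restriction.
have -> : subset_of (sval @` \bigcup_n F n) =
    \bigcup_n subset_of (sval @` F n) :> set (powerset_space S0).
  by rewrite image_bigcup; apply/seteqP; split.
apply: measure_semi_sigma_additive => //.
apply/trivIsetP => i j _ _ ij; rewrite -subset0 => x [[a Fa ax] [b Fb bx]].
(* Disjointness passes to the images because [sval] is injective. *)
have ab : a = b by apply: val_inj; rewrite /= ax bx.
move/trivIsetP : tF => /(_ i j I I ij); rewrite -subset0; apply.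
by split; [exact: Fa | rewrite ab].
Qed.

HB.instance Definition _ := isMeasure.Build _ _ _ measure_restriction
  restriction0 restriction_ge0 restriction_sigma_additive.

Lemma measure_restrictionE (B : set U) : B `<=` A ->
  measure_restriction (subset_of B) = mu (subset_of B).
Proof.
move=> BA; congr (mu _); apply/seteqP; split => x /=.
  by move=> [y By]; rewrite /subset_of /= => <-.
by move=> Bx; exists (exist _ (sval x) (mem_set (BA _ Bx))).
Qed.

Lemma exists_probability_restriction : mu (subset_of A) = 1 ->
  exists P : probability (powerset_space A0) R,
    forall B : set U, B `<=` A -> P (subset_of B) = mu (subset_of B).
Proof.
move=> muA1; have total : measure_restriction setT = 1.
  rewrite -muA1 -measure_restrictionE//; congr (measure_restriction _).
  by apply/seteqP; split => // x _; exact: set_mem (svalP x).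
(* The total mass is 1 only under the local hypothesis [muA1], so the probability structure is
   packed inside the proof. *)
pose m := Measure_isProbability.Build _ _ _ measure_restriction total.
pose P : probability _ R := HB.pack measure_restriction m.
by exists P; exact: measure_restrictionE.
Qed.

End restriction.

(** * Initial segments, bar induction along a front, and masses above a node *)

Section trees.
Context (X : Type).
Implicit Types (T : tree X) (A : set (seq X)) (s t u : seq X).

Lemma initial_refl s : initial s s.
Proof. by exists [::]; rewrite cats0. Qed.

Lemma initial_trans {s t u} : initial s t -> initial t u -> initial s u.
Proof. by move=> [a ->] [b ->]; exists (a ++ b); rewrite catA. Qed.

Lemma initial_take n s : initial (take n s) s.
Proof. by exists (drop n s); rewrite cat_take_drop. Qed.

Lemma initialE {s t} : initial s t -> s = take (size s) t.
Proof. by move=> [u ->]; rewrite take_size_cat. Qed.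

Lemma initial_comparable {s t u} : initial s u -> initial t u ->
  (size s <= size t)%N -> initial s t.
Proof.
move=> /initialE su /initialE tu st; exists (drop (size s) t).
by rewrite -{1}[t](cat_take_drop (size s)) {1}tu take_takel// -su.
Qed.

Lemma initial_size_le {s t} : initial s t -> (size s <= size t)%N.
Proof. by move=> [u ->]; rewrite size_cat leq_addr. Qed.

Lemma initial_size_eq {s t} : initial s t -> size s = size t -> s = t.
Proof. by move=> /initialE st sizest; rewrite st sizest take_size. Qed.

(** The invariant of the bar induction. Membership of [t] itself in [A] is allowed, since that is
    where the induction stops. *)
Definition not_past A t := forall s, A s -> initial s t -> s = t.

(** A member of [A] below [t'] and shorter than it is already below [t], hence equal to [t], which
    is outside [A]. *)
Lemma not_past_succ T A t t' :
  not_past A t -> ~ A t -> tree_succ T t t' -> not_past A t'.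
Proof.
move=> tA nAt [_ tt' size_t'] s As st'.
have := initial_size_le st'; rewrite leq_eqVlt => /orP[/eqP|].
  exact: initial_size_eq.
rewrite size_t' ltnS => sizest; have st := initial_comparable st' tt' sizest.
by case: nAt; rewrite -(tA s).
Qed.

Lemma not_past_front T A t : front T A -> A t -> not_past A t.
Proof.
move=> [_ antiA _] At s As st; apply: contrapT => nst.
by have [] := antiA _ _ As At nst.
Qed.

(** The branch is read off diagonally, its entry [n] being that of [f n.+1]. As [f 0] may have any
    length, [mkseq x n] is in general only an initial segment of [f n]. *)
Lemma chain_limit T (f : nat -> seq X) :
  (forall n, tree_succ T (f n) (f n.+1)) ->
  exists2 x, tree_lim T x & forall n, initial (mkseq x n) (f n).
Proof.
move=> fS.
have size_f n : (n <= size (f n))%N.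
  by elim: n => // n IH; have [_ _ ->] := fS n.
have f_mono m n : (m <= n)%N -> initial (f m) (f n).
  elim: n => [|n IH]; first by rewrite leqn0 => /eqP ->; exact: initial_refl.
  rewrite leq_eqVlt => /orP[/eqP ->|]; first exact: initial_refl.
  rewrite ltnS => /IH fm; have [_ fn _] := fS n; exact: initial_trans fn.
(* The default value for [nth] comes from the nonempty sequence [f 1], as [X] is not assumed
   inhabited. *)
have [x0 _] : exists x0 : X, True.
  by have := size_f 1%N; case: (f 1%N) => // x0 _ _; exists x0.
pose x n := nth x0 (f n.+1) n.
have xE n : mkseq x n = take n (f n).
  apply: (@eq_from_nth _ x0) => [|i]; rewrite size_mkseq ?size_takel// => ltin.
  rewrite nth_mkseq// nth_take// /x.
  by have [v ->] := f_mono _ _ ltin; rewrite nth_cat size_f.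
exists x => n; rewrite xE; last exact: initial_take.
apply: (@nodes_initial _ T _ (f n)); first exact: initial_take.
(* The hypothesis makes only the terms [f n.+1] nodes; [f 0] is one as an initial segment of
   [f 1]. *)
case: n {xE} => [|n]; last by have [] := fS n.
by have [f1 f01 _] := fS 0%N; exact: nodes_initial f1.
Qed.

(** A counterexample that is not past [A] has a successor of the same kind, so dependent choice
    yields an infinite chain. The front meets its limit in an initial segment of some [f n]; as
    [f n] is not past [A], it lies in [A], hence in [Q]. *)
Lemma front_bar_induction T A (Q : set (seq X)) : front T A ->
  A `<=` Q ->
  (forall t, nodes T t -> ~ tree_max T t -> ~ A t ->
     (forall t', tree_succ T t t' -> Q t') -> Q t) ->
  forall t, nodes T t -> not_past A t -> Q t.
Proof.
move=> frontA AQ step t0 Tt0 pt0; apply: contrapT => nQt0.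
have [_ _ metA] := frontA.
pose bad t := [/\ nodes T t, not_past A t & ~ Q t].
have next (t : {t | bad t}) :
    {t' : {t | bad t} | tree_succ T (sval t) (sval t')}.
  apply: cid; case: t => t [Tt pt nQt] /=; apply: contrapT => noext.
  apply: nQt; have [/AQ//|nAt] := pselect (A t).
  apply: step => // [tmax|t' tt'].
    (* A maximal [t] is itself a branch, so the front contains an initial segment of it, which can
       only be [t]. *)
    have [|n /= An] := metA (inr t); first by right; exists t.
    by apply: nAt; rewrite -(pt _ An) //; exact: initial_take.
  apply: contrapT => nQt'; apply: noext.
  have bt' : bad t'.
    by split=> //; [case: tt' | exact: not_past_succ tt'].
  by exists (exist _ t' bt').
have bt0 : bad t0 by [].
have [f [_ fS]] := dependent_choice next (exist _ t0 bt0).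
have [x Tx xf] := chain_limit _ _ fS.
have [|n /= An] := metA (inl x); first by left; exists x.
case: (svalP (f n)) => _ pfn; apply.
by apply: AQ; rewrite -(pfn _ An).
Qed.

(** A member of [A] above [t] is longer than [t], so its truncation to length [(size t).+1] is a
    successor of [t]. *)
Lemma above_succ T A t : A `<=` nodes T -> ~ A t ->
  [set s | A s /\ initial t s] =
  \bigcup_(t' in tree_succ T t) [set s | A s /\ initial t' s].
Proof.
move=> AT nAt; apply/seteqP; split=> [s [As ts]|s [t' [_ tt' _] [As t's]]].
  have ltts : (size t < size s)%N.
    rewrite ltn_neqAle initial_size_le// andbT; apply/eqP => sizets.
    by apply: nAt; rewrite (initial_size_eq ts).
  have size_t' : size (take (size t).+1 s) = (size t).+1 by rewrite size_takel.
  exists (take (size t).+1 s); last by split=> //; exact: initial_take.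
  split=> //; first exact: nodes_initial (initial_take _ _) (AT _ As).
  by apply: initial_comparable ts (initial_take _ _) _; rewrite size_t'.
by split=> //; exact: initial_trans t's.
Qed.

Lemma front_above T A (R : realType)
    (Xi : {measure set (powerset_space (nodes_neq0 T)) -> \bar R}) :
  countable (nodes T) -> inductive_probability Xi -> front T A ->
  forall t, nodes T t -> not_past A t ->
  Xi (subset_of [set t]) = Xi (subset_of [set s | A s /\ initial t s]).
Proof.
move=> cT [_ Xi_succ] frontA; have [AT _ _] := frontA.
apply: (front_bar_induction _ _ _ frontA) => [t At | t Tt nmaxt nAt IH] /=.
  congr (Xi (subset_of _)); apply/seteqP; split => [s ->|s [As ts]].
    by split=> //; exact: initial_refl.
  by rewrite /= (not_past_front _ _ _ frontA As t).
rewrite -Xi_succ//.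
pose F (t' : seq X) : set (powerset_space (nodes_neq0 T)) := subset_of [set t'].
pose G (t' : seq X) : set (powerset_space (nodes_neq0 T)) :=
  subset_of [set s | A s /\ initial t' s].
transitivity (Xi (\bigcup_(t' in tree_succ T t) F t')).
  congr (Xi _); apply/seteqP; split=> [s st|s [t' st']].
    by exists (sval s).
  by rewrite /F /subset_of /= => ->.
transitivity (Xi (\bigcup_(t' in tree_succ T t) G t')); last first.
  by congr (Xi _); rewrite (above_succ _ _ _ AT nAt); apply/seteqP; split.
(* Equality of the masses of [F t'] and [G t'] is the induction hypothesis; countability and
   disjointness remain. *)
apply: measure_countable_bigcup_eq => //.
- by apply: sub_countable cT; apply: subset_card_le => s [].
- by move=> t1 t2 _ _ [s [/= <- <-]].
(* Two successors of [t] below the same [s] are both its truncation to length [(size t).+1]. *)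
- move=> t1 t2 [_ _ size1] [_ _ size2] [s [[_ /initialE t1s] [_ /initialE t2s]]].
  by rewrite t1s t2s size1 size2.
Qed.

End trees.

Theorem theorem4p15 (R : realType) (X : Type) (T : tree X)
  (countableT : countable (nodes T))
  (Xi : {measure set (powerset_space (nodes_neq0 T)) -> \bar R})
  (Xi_inductive : inductive_probability Xi)
  (A : set (seq X)) (frontA : front T A) :
  (exists (A0 : A !=set0) (P : probability (powerset_space A0) R),
     forall B : set (seq X), B `<=` A -> P (subset_of B) = Xi (subset_of B)) /\
  (forall t : seq X, nodes T t -> (exists2 s, A s & initial t s) ->
     Xi (subset_of [set t]) = Xi (subset_of [set s | A s /\ initial t s])).
Proof.
have above := front_above _ _ _ _ _ countableT Xi_inductive frontA.
split=> [|t Tt [s As ts]]; last first.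
  apply: above => // r Ar rt.
  (* Here [r] is below [t] and [t] below [s], with [r] and [s] in [A]: incompatibility forces
     [r = s], and then [t] has the same length as both. *)
  have rs := not_past_front _ _ _ _ frontA As _ Ar (initial_trans _ rt ts).
  by apply: (initial_size_eq _ rt); apply/eqP; rewrite eqn_leq
    (initial_size_le _ rt) rs (initial_size_le _ ts).
have XiA1 : Xi (subset_of A) = 1.
  (* At the root, every member of [A] lies above, and the only initial segment is the root itself,
     so it is not past [A]. *)
  have [<- _] := Xi_inductive; rewrite above.
  - congr (Xi (subset_of _)); apply/seteqP; split=> [s As|s []//].
    by split=> //; exists s.
  - by have [t Tt] := nodes_neq0 T; apply: nodes_initial Tt; exists t.
  - by move=> [|x s] // _ [].
have A0 : A !=set0.
  apply/set0P/eqP => A0; move/eqP: XiA1; rewrite A0.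
  have -> : subset_of set0 = set0 :> set (powerset_space (nodes_neq0 T)).
    by apply/seteqP; split.
  by rewrite measure0 eq_sym onee_eq0.
by exists A0; exact: exists_probability_restriction.
Qed.
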